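(* Let $C\in\mathbb{R}_+^{n\times m}$ with $C\neq0$, $r\in\Delta^n$, $c\in\Delta^m$, $\alpha>0$, and run the LAMP recursion with $\tau_1=\tau_2=1/(2\|C\|_\infty)$, $\eta=0$ and clipping parameter $\beta=\log 3$. Let $(X^*,\theta^* )\in\Pi(r,c)\times[-1/2,1/2]^m$ be a saddle-point of $K^0$ (minimized over row-feasible couplings, maximized over $[-1,1]^m$) such that $X^*$ is also a minimizer of $\min_{X\in\Pi(r,c)}\langle C,X\rangle$. Define $X^t:=\mathcal{D}_rp^{\eta_t}(\nu^t)$ for $t\ge0$ and $\bar X^t:=\mathcal{D}_rp^{\eta_t}(\bar\nu^t)$ for $t\ge1$. Then for all $t\ge1$: (a) With $\widetilde X^t=\operatorname{Round}(X^t,r,c)$, $$\langle C,\widetilde X^t-X^*\rangle\le 4\|C\|_\infty\|\mathbf c(X^t)-c\|_1+\frac{2\|C\|_\infty\log m}{t}.$$ (b) With $$D_t:=\sum_{s=0}^{t-1}\Bigl[\mathrm{D}_{H_c^\alpha}(\bar\theta^{s+1}\|\hat\theta^{s+1})-\mathrm{D}_{H_c^\alpha}(\bar\theta^{s+1}\|\theta^{s})+\mathrm{D}_{\mathrm{KL}}(\bar X^{s+1}\|X^{s+1})-\mathrm{D}_{\mathrm{KL}}(\bar X^{s+1}\|X^{s})\Bigr],$$ one has $$\min_{1\le s\le t}\{K^0(\bar X^s,\theta^* )-K^0(X^*,\bar\theta^s)\}\le\frac{2\|C\|_\infty[\log m+(1+\alpha)\log2+D_t]}{t}.$$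
   Context: Notation. $\Delta^k$ is the probability simplex in $\mathbb{R}^k$; $\|\cdot\|_1,\|\cdot\|_\infty$ are entrywise norms; $\langle\cdot,\cdot\rangle$ is the Euclidean (entrywise) inner product; $\mathcal{D}_r$ is the diagonal matrix with diagonal $r$; $\mathbf r(X)$ and $\mathbf c(X)$ are the vectors of row sums and column sums of $X$; $\Pi(r,c)=\{X\in\mathbb{R}_+^{n\times m}:\mathbf r(X)=r,\ \mathbf c(X)=c\}$; $\Delta_r^{n\times m}=\{X\in\mathbb{R}_+^{n\times m}:\mathbf r(X)=r\}$; $c^\alpha=c+(\alpha/m)\mathbf 1_m$. Saddle function. $K^0(X,\theta)=\langle C,X\rangle+2\|C\|_\infty\langle\theta,\mathbf c(X)-c\rangle$. A saddle-point is a pair $(X^*,\theta^* )\in\Delta_r^{n\times m}\times[-1,1]^m$ with $K^0(X^*,\theta)\le K^0(X^*,\theta^* )\le K^0(X,\theta^* )$ for all $X\in\Delta_r^{n\times m}$, $\theta\in[-1,1]^m$. Divergences. $\mathrm{D}_{\mathrm{KL}}(X\|Y)=\sum_{ij}X_{ij}\log(X_{ij}/Y_{ij})$ for nonnegative matrices of equal total mass, with $0\log0=0$ and $0\log(0/0)=0$. For $\theta\in[-1,1]^m$, $\nu\in(-1,1)^m$, $$\mathrm{D}_{H_c^\alpha}(\theta\|\nu)=\sum_{j=1}^mc_j^\alpha\Bigl(\frac{1+\theta_j}{2}\log\frac{1+\theta_j}{1+\nu_j}+\frac{1-\theta_j}{2}\log\frac{1-\theta_j}{1-\nu_j}\Bigr),$$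 the Bregman divergence of $H_c^\alpha(\nu)=\sum_jc^\alpha_j\bigl(\frac{1+\nu_j}{2}\ln\frac{1+\nu_j}{2}+\frac{1-\nu_j}{2}\ln\frac{1-\nu_j}{2}\bigr)$. LAMP recursion with these parameters. Here $\eta_0=\infty$ and $\eta_t=2\|C\|_\infty/t$ for $t\ge1$, and for $t\ge0$ and $\theta\in[-1,1]^m$, $p^{\eta_t}(\theta)$ is the row-stochastic matrix with $$p^{\eta_t}(\theta)_{ij}=\frac{\exp[-t(C_{ij}/(2\|C\|_\infty)+\theta_j)]}{\sum_k\exp[-t(C_{ik}/(2\|C\|_\infty)+\theta_k)]}$$ (so $p^{\eta_0}(\theta)_{ij}=1/m$). Start from $\theta^0=\nu^0=\mathbf 0_m$; for $t\ge0$: $\bar\nu^{t+1}=\frac{t}{t+1}\nu^t+\frac1{t+1}\theta^t$; $\bar\theta^{t+1}=\operatorname{argmax}_{\theta}\{\langle\mathbf c(\mathcal{D}_rp^{\eta_t}(\nu^t))-c,\theta\rangle-\mathrm{D}_{H_c^\alpha}(\theta\|\theta^t)\}$; $\nu^{t+1}=\frac{t}{t+1}\nu^t+\frac1{t+1}\bar\theta^{t+1}$; $\hat\theta^{t+1}=\operatorname{argmax}_{\theta}\{\langle\mathbf c(\mathcal{D}_rp^{\eta_{t+1}}(\bar\nu^{t+1}))-c,\theta\rangle-\mathrm{D}_{H_c^\alpha}(\theta\|\theta^t)\}$; $\theta^{t+1}$ is $\hat\theta^{t+1}$ clipped coordinatewise to $[-\tanh(\beta/2),\tanh(\beta/2)]=[-1/2,1/2]$.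 Here the maximizer over $\theta\in[-1,1]^m$ of $\langle g,\theta\rangle-\mathrm{D}_{H_c^\alpha}(\theta\|\theta^t)$ is $\theta_j=\tanh\bigl[g_j/c_j^\alpha+\frac12\log\frac{1+\theta^t_j}{1-\theta^t_j}\bigr]$. Rounding. $\operatorname{Round}(X,r,c)$ for $X\in\mathbb{R}_+^{n\times m}$: set $X'=\mathcal{D}_xX$ with $x_i=\min\{r_i/\mathbf r(X)_i,1\}$; $X''=X'\mathcal{D}_y$ with $y_j=\min\{c_j/\mathbf c(X')_j,1\}$; $\delta_r=r-\mathbf r(X'')$, $\delta_c=c-\mathbf c(X'')$; output $X''+\|\delta_r\|_1^{-1}\delta_r\delta_c^\top$ (output $X''$ if $\delta_r=0$; a ratio with zero denominator is treated as making the minimum equal to $1$). The output lies in $\Pi(r,c)$. *)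

(* Defs.v *)
From mathcomp Require Import all_boot all_order all_algebra.
From mathcomp Require Import all_classical all_reals all_analysis.

Set Implicit Arguments.
Unset Strict Implicit.
Unset Printing Implicit Defensive.

Import Order.TTheory GRing.Theory Num.Theory.

Local Open Scope classical_set_scope.
Local Open Scope ring_scope.

(* All vectors of R^k, including row marginals, are row vectors 'rV[R]_k. The
   entrywise sup norm of a matrix is the library's [mx_norm]. *)

Section matrices.
Context {R : realType}.

Definition simplex (k : nat) : set 'rV[R]_k :=
  [set v | (forall i, 0 <= v 0 i) /\ \sum_i v 0 i = 1].

Definition cube (k : nat) (b : R) : set 'rV[R]_k :=
  [set v | forall i, - b <= v 0 i <= b].

Definition nonneg_mx (n m : nat) (X : 'M[R]_(n, m)) : Prop :=
  forall i j, 0 <= X i j.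

Definition inner (n m : nat) (X Y : 'M[R]_(n, m)) : R :=
  \sum_i \sum_j X i j * Y i j.

Definition norm1 (n m : nat) (X : 'M[R]_(n, m)) : R :=
  \sum_i \sum_j `|X i j|.

Definition row_sums (n m : nat) (X : 'M[R]_(n, m)) : 'rV[R]_n :=
  \row_i \sum_j X i j.

Definition col_sums (n m : nat) (X : 'M[R]_(n, m)) : 'rV[R]_m :=
  \row_j \sum_i X i j.

Definition couplings (n m : nat) (r : 'rV[R]_n) (c : 'rV[R]_m) :
    set 'M[R]_(n, m) :=
  [set X | [/\ nonneg_mx X, row_sums X = r & col_sums X = c]].

Definition row_feasible (n m : nat) (r : 'rV[R]_n) : set 'M[R]_(n, m) :=
  [set X | nonneg_mx X /\ row_sums X = r].

End matrices.

Section optimality.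
Context {R : realType}.

Definition is_argmin (T : Type) (A : set T) (f : T -> R) (x : T) : Prop :=
  A x /\ forall y, A y -> f x <= f y.

Definition is_argmax (T : Type) (A : set T) (f : T -> R) (x : T) : Prop :=
  A x /\ forall y, A y -> f y <= f x.

Definition is_saddle_point (T U : Type) (A : set T) (B : set U)
    (K : T -> U -> R) (x : T) (u : U) : Prop :=
  [/\ A x, B u & forall y v, A y -> B v -> K x v <= K x u <= K y u].

(* F 1 is only the seed of the iterated minimum: for t >= 1 it is already one of
   the terms, so this is the minimum of F 1, ..., F t. *)
Definition min_from1 (F : nat -> R) (t : nat) : R :=
  \big[Order.min/F 1%N]_(1 <= s < t.+1) F s.

Definition saddle_fun (n m : nat) (C : 'M[R]_(n, m)) (c : 'rV[R]_m)
    (X : 'M[R]_(n, m)) (theta : 'rV[R]_m) : R :=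
  inner C X + 2 * mx_norm C * inner theta (col_sums X - c).

End optimality.

Section divergences.
Context {R : realType}.

(* Division by 0 and ln of a nonpositive number are 0 in the library, so the
   conventions 0 log 0 = 0 log (0 / 0) = 0 hold. The formula is the usual
   divergence only when Y i j = 0 implies X i j = 0 (else it would be +oo). *)
Definition KL (n m : nat) (X Y : 'M[R]_(n, m)) : R :=
  \sum_i \sum_j X i j * ln (X i j / Y i j).

Definition smoothed (m : nat) (c : 'rV[R]_m) (alpha : R) : 'rV[R]_m :=
  c + const_mx (alpha / m%:R).

Definition DH (m : nat) (c : 'rV[R]_m) (alpha : R) (theta nu : 'rV[R]_m) : R :=
  \sum_j smoothed c alpha 0 j *
    ((1 + theta 0 j) / 2 * ln ((1 + theta 0 j) / (1 + nu 0 j)) +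
     (1 - theta 0 j) / 2 * ln ((1 - theta 0 j) / (1 - nu 0 j))).

End divergences.

Section lamp.
Context {R : realType}.

(* The row-stochastic matrix p^{eta_t}(theta) for eta_t = 2 |C|_oo / t; the case
   t = 0, i.e. eta_0 = +oo, is the uniform matrix. *)
Definition softmin (n m : nat) (C : 'M[R]_(n, m)) (t : nat)
    (theta : 'rV[R]_m) : 'M[R]_(n, m) :=
  let w i j := expR (- (t%:R * (C i j / (2 * mx_norm C) + theta 0 j))) in
  \matrix_(i, j) (w i j / \sum_k w i k).

Definition primal (n m : nat) (C : 'M[R]_(n, m)) (r : 'rV[R]_n) (t : nat)
    (theta : 'rV[R]_m) : 'M[R]_(n, m) :=
  diag_mx r *m softmin C t theta.

Definition tanh (x : R) : R :=
  (expR x - expR (- x)) / (expR x + expR (- x)).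

Definition clip (m : nat) (b : R) (v : 'rV[R]_m) : 'rV[R]_m :=
  \row_j Order.max (- b) (Order.min (v 0 j) b).

Definition mirror_step (n m : nat) (c : 'rV[R]_m) (alpha : R)
    (X : 'M[R]_(n, m)) (theta theta' : 'rV[R]_m) : Prop :=
  is_argmax (cube 1)
    (fun u => inner (col_sums X - c) u - DH c alpha u theta) theta'.

(* The step sizes tau_1 = tau_2 = 1 / (2 |C|_oo) and eta = 0 are built in. Index 0
   of [bnu], [btheta] and [htheta] (bar nu, bar theta, hat theta) is junk. *)
Record lamp_run (n m : nat) (C : 'M[R]_(n, m)) (r : 'rV[R]_n) (c : 'rV[R]_m)
    (alpha beta : R) (nu theta bnu btheta htheta : nat -> 'rV[R]_m) : Prop := {
  lamp_nu0 : nu 0%N = 0;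
  lamp_theta0 : theta 0%N = 0;
  lamp_bnu : forall t : nat, bnu t.+1 =
    (t%:R / t.+1%:R) *: nu t + (1 / t.+1%:R) *: theta t;
  lamp_btheta : forall t : nat,
    mirror_step c alpha (primal C r t (nu t)) (theta t) (btheta t.+1);
  lamp_nu : forall t : nat, nu t.+1 =
    (t%:R / t.+1%:R) *: nu t + (1 / t.+1%:R) *: btheta t.+1;
  lamp_htheta : forall t : nat,
    mirror_step c alpha (primal C r t.+1 (bnu t.+1)) (theta t) (htheta t.+1);
  lamp_theta : forall t : nat, theta t.+1 = clip (tanh (beta / 2)) (htheta t.+1)
}.

End lamp.

Section rounding.
Context {R : realType}.

Definition capped_ratio (a b : R) : R :=
  if b == 0 then 1 else Order.min (a / b) 1.

Definition Round (n m : nat) (X : 'M[R]_(n, m)) (r : 'rV[R]_n)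
    (c : 'rV[R]_m) : 'M[R]_(n, m) :=
  let x := \row_i capped_ratio (r 0 i) (row_sums X 0 i) in
  let X' := diag_mx x *m X in
  let y := \row_j capped_ratio (c 0 j) (col_sums X' 0 j) in
  let X'' := X' *m diag_mx y in
  let dr := r - row_sums X'' in
  let dc := c - col_sums X'' in
  if dr == 0 then X'' else X'' + (norm1 dr)^-1 *: (dr^T *m dc).

End rounding.

(* Main.v *)
(* Put N = |C|_oo. Since t nu^t = bar theta^1 + ... + bar theta^t, X^(t+1) is the
   entropic mirror descent step from X^t for the cost C / (2N) + bar theta^(t+1);
   likewise hat theta^(t+1) is a mirror step from theta^t in the geometry of H, and
   clipping to [-1/2, 1/2] does not increase the divergence from theta^*. The
   three-point identities of both steps add up to the duality gap over 2N, all
   bilinear terms cancelling as X^* has column sums c; telescoping gives (b). For (a),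
   comparing X^t with the uniform row-feasible matrix by the same identity bounds
   <C, X^t - X^*>, and rounding costs at most N |c(X^t) - c|_1. *)

Require Import Defs.
From mathcomp Require Import all_boot all_order all_algebra.
From mathcomp Require Import all_classical all_reals all_analysis.
From mathcomp Require Import ring lra.

Set Implicit Arguments.
Unset Strict Implicit.
Unset Printing Implicit Defensive.

Import Order.TTheory GRing.Theory Num.Theory.

Local Open Scope classical_set_scope.
Local Open Scope ring_scope.

(** * The binary relative entropy: positivity, three-point identity, clipping *)

Section binary_divergence.
Context {R : realType}.
Implicit Types a b h x y : R.

(** The relative entropy of the two-point law with masses [(1 + a) / 2], [(1 - a) / 2] with respect
    to the one given by [b]; [DH] is its [smoothed]-weighted sum over coordinates. *)
Definition bern a b : R :=
  (1 + a) / 2 * ln ((1 + a) / (1 + b)) + (1 - a) / 2 * ln ((1 - a) / (1 - b)).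

(** On the open interval from -1 to 1 this is the inverse of [tanh], and the derivative of the
    negative binary entropy that generates [bern]. *)
Definition logit b : R := (ln (1 + b) - ln (1 - b)) / 2.

Lemma ln_le_subr1 x : 0 < x -> ln x <= x - 1.
Proof. by move=> x0; have := @le_ln1Dx R (x - 1); rewrite subrKC; apply; lra. Qed.

Lemma ln_eq_subr1 x : 0 < x -> ln x = x - 1 -> x = 1.
Proof.
move=> x0 e; have [l0|l0] := eqVneq (ln x) 0; first lra.
by have := expR_gt1Dx l0; rewrite lnK ?posrE// e; lra.
Qed.

Lemma mulr_ln_div x y : 0 <= x -> 0 < y -> x * ln (x / y) = x * ln x - x * ln y.
Proof.
rewrite le_eqVlt => /orP[/eqP <-|x0] y0; first by rewrite !mul0r subr0.
by rewrite ln_div ?posrE// mulrBr.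
Qed.

(** This is [ln z <= z - 1] at [z = y / x], multiplied by [x]. The linear lower bound vanishes after
    summation over equal masses, which makes divergences nonnegative. *)
Lemma xlnx_ge x y : 0 <= x -> 0 <= y -> (y = 0 -> x = 0) -> x - y <= x * ln (x / y).
Proof.
rewrite le_eqVlt => /orP[/eqP <-|x0]; first by rewrite mul0r sub0r oppr_le0.
rewrite le_eqVlt => /orP[/eqP <-|y0] xy.
- by have := xy erefl; lra.
- have := ln_le_subr1 (divr_gt0 y0 x0).
  rewrite -(ler_pM2l x0) !ln_div ?posrE// !mulrBr mulr1 mulrCA divff ?gt_eqF//.
  lra.
Qed.

Lemma xlnx_eq x y : 0 <= x -> 0 < y -> x * ln (x / y) = x - y -> x = y.
Proof.
rewrite le_eqVlt => /orP[/eqP <-|x0] y0; first by rewrite mul0r; lra.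
move=> e.
have : y / x = 1.
  apply: ln_eq_subr1; first exact: divr_gt0.
  apply: (mulfI (lt0r_neq0 x0)); rewrite mulrBr mulrCA divff ?gt_eqF// mulr1.
  by move: e; rewrite !ln_div ?posrE// !mulrBr; lra.
by move=> /(congr1 ( *%R^~ x)); rewrite divfK ?gt_eqF// mul1r.
Qed.

Lemma bern_ge0 a b : -1 <= a <= 1 -> -1 < b < 1 -> 0 <= bern a b.
Proof.
move=> /andP[a0 a1] /andP[b0 b1]; rewrite /bern.
have := @xlnx_ge (1 + a) (1 + b); have := @xlnx_ge (1 - a) (1 - b).
move=> /(_ ltac:(lra) ltac:(lra) ltac:(lra)) h1.
move=> /(_ ltac:(lra) ltac:(lra) ltac:(lra)) h2.
lra.
Qed.

Lemma bern_eq0 a b : -1 <= a <= 1 -> -1 < b < 1 -> bern a b = 0 -> a = b.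
Proof.
move=> /andP[a0 a1] /andP[b0 b1]; rewrite /bern => e.
have := @xlnx_ge (1 + a) (1 + b); have := @xlnx_ge (1 - a) (1 - b).
move=> /(_ ltac:(lra) ltac:(lra) ltac:(lra)) h1.
move=> /(_ ltac:(lra) ltac:(lra) ltac:(lra)) h2.
(* The lower bounds of the two logarithmic terms are opposite, so a zero sum forces equality in
   each. *)
have := @xlnx_eq (1 + a) (1 + b) ltac:(lra) ltac:(lra) ltac:(lra).
by lra.
Qed.

Lemma bernxx a : bern a a = 0.
Proof.
have ln1' x : ln (x / x) = 0 :> R.
  by have [->|x0] := eqVneq x 0; [rewrite mul0r ln0|rewrite divff// ln1].
by rewrite /bern !ln1' !mulr0 addr0.
Qed.

Lemma bernNN a b : bern (- a) (- b) = bern a b.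
Proof. by rewrite /bern !opprK addrC. Qed.

(** The entropy of [a] cancels, so the difference is affine in [a]; differencing once more in [a]
    removes the constant and gives the three-point identity. *)
Lemma bern_sub a b h : -1 <= a <= 1 -> -1 < b < 1 -> -1 < h < 1 ->
  bern a b - bern a h = a * (logit h - logit b) +
    (ln (1 + h) + ln (1 - h) - ln (1 + b) - ln (1 - b)) / 2.
Proof.
move=> /andP[a0 a1] /andP[b0 b1] /andP[h0 h1].
by rewrite /bern /logit !(mulrAC _ 2^-1) !mulr_ln_div; lra.
Qed.

Lemma bern_three_point a a' b h : -1 <= a <= 1 -> -1 <= a' <= 1 ->
    -1 < b < 1 -> -1 < h < 1 ->
  bern a b - bern a h - bern a' b + bern a' h = (a - a') * (logit h - logit b).
Proof.
move=> a1 a1' b1 h1.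
have := @bern_sub a b h a1 b1 h1; have := @bern_sub a' b h a1' b1 h1.
lra.
Qed.

Lemma logit_le a b : -1 < a -> a <= b -> b < 1 -> logit a <= logit b.
Proof.
move=> a1 ab b1; rewrite /logit.
have : ln (1 + a) <= ln (1 + b) by rewrite ler_ln ?posrE; lra.
have : ln (1 - b) <= ln (1 - a) by rewrite ler_ln ?posrE; lra.
lra.
Qed.

(** The three-point identity at [a' = b] writes [bern a h] as [bern a b + bern b h + (b - a) *
    (logit h - logit b)], whose last two terms are nonnegative. *)
Lemma bern_le_trunc a b h : -1 <= a -> -1 < b -> a <= b -> b <= h -> h < 1 ->
  bern a b <= bern a h.
Proof.
move=> a1 b1 ab bh h1.
have := @bern_three_point a b b h.
rewrite bernxx => /(_ ltac:(lra) ltac:(lra) ltac:(lra) ltac:(lra)) e.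
have := @bern_ge0 b h ltac:(lra) ltac:(lra).
have : (b - a) * (logit h - logit b) >= 0.
  by apply: mulr_ge0; rewrite subr_ge0//; apply: logit_le.
lra.
Qed.

Lemma bern_clip a b h : 0 <= b < 1 -> - b <= a <= b -> -1 < h < 1 ->
  bern a (Order.max (- b) (Order.min h b)) <= bern a h.
Proof.
move=> /andP[b0 b1] /andP[a0 a1] /andP[h0 h1].
have [hb|hb] := leP h b; last first.
  by rewrite max_r; [apply: bern_le_trunc|]; lra.
have [bh|bh] := leP (- b) h; first by [].
(* Truncation from below is truncation from above after changing all signs. *)
by rewrite -bernNN opprK -(bernNN a h); apply: bern_le_trunc; lra.
Qed.

Lemma logit_surj x : exists2 u, -1 < u < 1 & logit u = x.
Proof.
have e0 := expR_gt0 x; have e1 := expR_gt0 (- x).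
exists (tanh x).
  by rewrite /tanh ltr_pdivlMr ?ltr_pdivrMr; lra.
have s0 : expR x + expR (- x) != 0 by rewrite gt_eqF; lra.
have -> : logit (tanh x) = (ln (2 * expR x / (expR x + expR (- x)))
                          - ln (2 * expR (- x) / (expR x + expR (- x)))) / 2.
  rewrite /logit /tanh; congr ((ln _ - ln _) / 2); field; exact: s0.
rewrite !ln_div ?lnM ?posrE ?expRK ?mulr_gt0//; lra.
Qed.

(** In terms of [expR (ln 3) = 3] the value is [(3 - 1) / (3 + 1)]: this is how [beta = ln 3] clips
    to the cube of radius 1/2. *)
Lemma tanh_ln3_half : tanh (ln 3 / 2) = 1 / 2 :> R.
Proof.
rewrite /tanh expRN; have e0 := expR_gt0 (ln 3 / 2 : R).
have e3 : expR (ln 3 / 2) * expR (ln 3 / 2) = 3 :> R.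
  by rewrite -expRD -splitr lnK ?posrE.
have e4 : expR (ln 3 / 2) != 0 :> R by rewrite gt_eqF.
have e5 : expR (ln 3 / 2) * expR (ln 3 / 2) + 1 != 0 :> R.
  by apply: lt0r_neq0; rewrite e3; lra.
have -> : (expR (ln 3 / 2) - (expR (ln 3 / 2))^-1) /
  (expR (ln 3 / 2) + (expR (ln 3 / 2))^-1) =
  (expR (ln 3 / 2) * expR (ln 3 / 2) - 1) /
  (expR (ln 3 / 2) * expR (ln 3 / 2) + 1) :> R.
  by field; rewrite e5.
by rewrite e3; field.
Qed.

End binary_divergence.

(** * The entrywise inner product and norms *)

Section matrices.
Context {R : realType}.

Lemma innerC n m (A X : 'M[R]_(n, m)) : inner A X = inner X A.
Proof. by apply: eq_bigr => i _; apply: eq_bigr => j _; rewrite mulrC. Qed.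

Lemma innerDl n m (A B X : 'M[R]_(n, m)) :
  inner (A + B) X = inner A X + inner B X.
Proof.
rewrite /inner -big_split; apply: eq_bigr => i _.
by rewrite -big_split; apply: eq_bigr => j _; rewrite mxE mulrDl.
Qed.

Lemma innerZl n m k (A X : 'M[R]_(n, m)) : inner (k *: A) X = k * inner A X.
Proof.
rewrite /inner mulr_sumr; apply: eq_bigr => i _.
by rewrite mulr_sumr; apply: eq_bigr => j _; rewrite mxE mulrA.
Qed.

Lemma innerNl n m (A X : 'M[R]_(n, m)) : inner (- A) X = - inner A X.
Proof. by rewrite -scaleN1r innerZl mulN1r. Qed.

Lemma innerDr n m (A X Y : 'M[R]_(n, m)) :
  inner A (X + Y) = inner A X + inner A Y.
Proof. by rewrite !(innerC A) innerDl. Qed.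

Lemma innerBr n m (A X Y : 'M[R]_(n, m)) :
  inner A (X - Y) = inner A X - inner A Y.
Proof. by rewrite innerDr (innerC A (- Y)) innerNl (innerC Y). Qed.

Lemma inner_row m (u v : 'rV[R]_m) : inner u v = \sum_j u 0 j * v 0 j.
Proof. by rewrite /inner big_ord1. Qed.

(** Repeating [th] in every row turns the dual term into a linear cost on matrices, which can then
    be added to [C]. *)
Lemma inner_col_sums n m (th : 'rV[R]_m) (X : 'M[R]_(n, m)) :
  inner (\matrix_(i < n) th) X = inner th (col_sums X).
Proof.
rewrite inner_row /inner exchange_big; apply: eq_bigr => j _.
by rewrite mxE mulr_sumr; apply: eq_bigr => i _; rewrite mxE.
Qed.

Lemma col_sumsB n m (X Y : 'M[R]_(n, m)) :
  col_sums (X - Y) = col_sums X - col_sums Y.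
Proof.
by apply/rowP => j; rewrite !mxE -sumrB; apply: eq_bigr => i _; rewrite !mxE.
Qed.

Lemma le_inner_nonneg n m (A X Y : 'M[R]_(n, m)) : nonneg_mx A ->
  (forall i j, X i j <= Y i j) -> inner A X <= inner A Y.
Proof.
by move=> A0 XY; apply: ler_sum => i _; apply: ler_sum => j _; apply: ler_wpM2l.
Qed.

Lemma norm1_ge0 n m (A : 'M[R]_(n, m)) : 0 <= norm1 A.
Proof. by apply: sumr_ge0 => i _; rewrite sumr_ge0. Qed.

Lemma norm_inner_cube m (u v : 'rV[R]_m) : cube 1 u -> `|inner u v| <= norm1 v.
Proof.
move=> u1; rewrite inner_row /norm1 big_ord1.
apply: (le_trans (ler_norm_sum _ _ _)); apply: ler_sum => j _.
by rewrite normrM ler_piMl// ler_norml.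
Qed.

Lemma norm_le_mx_norm n m (A : 'M[R]_(n, m)) i j : `|A i j| <= mx_norm A.
Proof.
rewrite mx_normrE; exact: (@le_bigmax _ R _ 0 (fun ij => `|A ij.1 ij.2|) (i, j)).
Qed.

Lemma mx_norm_gt0 n m (A : 'M[R]_(n, m)) : A <> 0 -> 0 < mx_norm A.
Proof.
move=> A0; rewrite lt_neqAle; apply/andP; split; last first.
  by rewrite mx_normE.
by rewrite eq_sym; apply/eqP => /mx_norm_eq0.
Qed.

End matrices.

(** * Row-wise Gibbs matrices and their KL divergences *)

Section gibbs.
Context {R : realType}.

Definition gibbs n m (r : 'rV[R]_n) (A : 'M[R]_(n, m)) : 'M[R]_(n, m) :=
  \matrix_(i, j) (r 0 i * (expR (- A i j) / \sum_k expR (- A i k))).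

Lemma partition_gt0 n m (A : 'M[R]_(n, m)) i (j : 'I_m) :
  0 < \sum_k expR (- A i k).
Proof.
rewrite (bigD1 j)//= ltr_wpDr ?expR_gt0//.
by apply: sumr_ge0 => k _; exact: expR_ge0.
Qed.

Lemma gibbs_row_feasible n m (r : 'rV[R]_n) (A : 'M[R]_(n, m.+1)) :
  simplex r -> row_feasible r (gibbs r A).
Proof.
move=> [r0 _]; split=> [i j|].
  rewrite mxE mulr_ge0// divr_ge0 ?expR_ge0//.
  by rewrite ltW// (partition_gt0 _ _ ord0).
apply/rowP => i; rewrite mxE; under eq_bigr do rewrite mxE.
by rewrite -mulr_sumr -mulr_suml divff ?mulr1// gt_eqF// (partition_gt0 _ _ ord0).
Qed.

Lemma row_feasible_le n m (r : 'rV[R]_n) (X : 'M[R]_(n, m)) i j :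
  row_feasible r X -> 0 <= X i j <= r 0 i.
Proof.
move=> [X0 <-]; rewrite X0 mxE (bigD1 j)//= lerDl.
by apply: sumr_ge0 => k _; exact: X0.
Qed.

Lemma sum_row_feasible n m (r : 'rV[R]_n) (X : 'M[R]_(n, m)) i :
  row_feasible r X -> \sum_j X i j = r 0 i.
Proof. by move=> [_ <-]; rewrite mxE. Qed.

(** Exponential weights are positive, so zeros come only from empty rows, where every row-feasible
    matrix vanishes too; [KL] against a Gibbs matrix is then the genuine divergence. *)
Lemma gibbs_eq0 n m (r : 'rV[R]_n) (A : 'M[R]_(n, m)) i j :
  gibbs r A i j = 0 -> r 0 i = 0.
Proof.
move=> /eqP; rewrite mxE mulf_eq0 => /orP[/eqP//|].
by rewrite gt_eqF// divr_gt0 ?expR_gt0// partition_gt0.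
Qed.

Lemma KL_gibbs_ge0 n m (r : 'rV[R]_n) (X A : 'M[R]_(n, m.+1)) :
  simplex r -> row_feasible r X -> 0 <= KL X (gibbs r A).
Proof.
move=> rS Xr; have gr := gibbs_row_feasible A rS.
(* Equal row sums make the linear lower bounds of [xlnx_ge] add up to zero. *)
have <- : \sum_i \sum_j (X i j - gibbs r A i j) = 0.
  by apply: big1 => i _; rewrite sumrB !(@sum_row_feasible _ _ r) ?subrr.
apply: ler_sum => i _; apply: ler_sum => j _.
have /andP[X0 X1] := row_feasible_le i j Xr.
apply: xlnx_ge => //; first by case: gr.
by move=> /gibbs_eq0 e; apply/eqP; rewrite eq_le X0 andbT -e.
Qed.

Lemma KLxx n m (X : 'M[R]_(n, m)) : KL X X = 0.
Proof.
apply: big1 => i _; apply: big1 => j _.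
by have [->|x0] := eqVneq (X i j) 0; rewrite ?mul0r// divff// ln1 mulr0.
Qed.

(** The logarithm of a Gibbs entry is [ln (r 0 i)] minus the cost minus the log-partition of its
    row. The last sum depends on [X] only through its row sums, so it cancels between two
    row-feasible matrices. *)
Lemma KL_gibbs_sub n m (r : 'rV[R]_n) (X A B : 'M[R]_(n, m)) :
    simplex r -> row_feasible r X ->
  KL X (gibbs r A) - KL X (gibbs r B) = inner (A - B) X +
   \sum_i r 0 i *
     (ln (\sum_k expR (- A i k)) - ln (\sum_k expR (- B i k))).
Proof.
move=> [r0 _] Xr; rewrite /KL /inner -sumrB -big_split; apply: eq_bigr => i _.
rewrite -(sum_row_feasible i Xr) mulr_suml -sumrB -big_split.
apply: eq_bigr => j _ /=.
have /andP[X0 X1] := row_feasible_le i j Xr.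
(* Zero entries contribute nothing; at the others [r 0 i] is positive as well, so all the logarithms
   split. *)
have [x0|x0] := eqVneq (X i j) 0; first by rewrite x0; lra.
have Xp : 0 < X i j by rewrite lt_neqAle eq_sym x0.
have rp : 0 < r 0 i by apply: lt_le_trans X1.
have ZA := partition_gt0 A i j; have ZB := partition_gt0 B i j.
rewrite !mxE !ln_div ?lnM ?posrE ?mulr_gt0 ?divr_gt0 ?expR_gt0 ?invr_gt0//.
rewrite !expRK !lnV ?posrE//; lra.
Qed.

Lemma KL_gibbs_three_point n m (r : 'rV[R]_n) (X Y A B : 'M[R]_(n, m)) :
    simplex r -> row_feasible r X -> row_feasible r Y ->
  KL X (gibbs r A) - KL X (gibbs r B) - KL Y (gibbs r A) + KL Y (gibbs r B) =
  inner (A - B) (X - Y).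
Proof.
move=> rS Xr Yr.
have := KL_gibbs_sub A B rS Xr; have := KL_gibbs_sub A B rS Yr.
rewrite innerBr; lra.
Qed.

(** [gibbs r 0] spreads each row mass uniformly, and an entry of [X] is at most its row sum, so
    every ratio is at most the number of columns. *)
Lemma KL_gibbs0_le n m (r : 'rV[R]_n) (X : 'M[R]_(n, m.+1)) :
  simplex r -> row_feasible r X -> KL X (gibbs r 0) <= ln m.+1%:R.
Proof.
move=> [r0 r1] Xr.
rewrite -[leRHS]mul1r -[X in X * _]r1 mulr_suml; apply: ler_sum => i _.
rewrite -(sum_row_feasible i Xr) mulr_suml; apply: ler_sum => j _.
have /andP[X0 X1] := row_feasible_le i j Xr.
have [->|x0] := eqVneq (X i j) 0; first by rewrite !mul0r.
have Xp : 0 < X i j by rewrite lt_neqAle eq_sym x0.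
have rp : 0 < r 0 i by apply: lt_le_trans X1.
apply: ler_wpM2l => //; rewrite mxE.
under eq_bigr do rewrite mxE oppr0 expR0.
rewrite mxE oppr0 expR0 sumr_const card_ord mul1r.
rewrite ler_ln ?posrE ?divr_gt0 ?mulr_gt0 ?invr_gt0 ?ltr0Sn//.
by rewrite ler_pdivrMr ?mulr_gt0 ?invr_gt0 ?ltr0Sn// mulrCA divff ?mulr1// pnatr_eq0.
Qed.

End gibbs.

(** * The cost of rounding *)

Section rounding.
Context {R : realType}.

Lemma inner_outer_le n m (C : 'M[R]_(n, m)) (u : 'rV_n) (v : 'rV_m) :
  inner C (u^T *m v) <= mx_norm C * (norm1 u * norm1 v).
Proof.
rewrite /norm1 !big_ord1 mulr_suml mulr_sumr; apply: ler_sum => i _.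
rewrite !mulr_sumr; apply: ler_sum => j _.
rewrite mxE big_ord1 mxE; apply: le_trans (ler_norm _) _.
by rewrite !normrM ler_wpM2r ?mulr_ge0// norm_le_mx_norm.
Qed.

Lemma col_sums_mul_diag n m (X : 'M[R]_(n, m)) (y : 'rV_m) j :
  col_sums (X *m diag_mx y) 0 j = col_sums X 0 j * y 0 j.
Proof.
rewrite [LHS]mxE [X in _ = X * _]mxE mulr_suml.
by apply: eq_bigr => i _; rewrite mul_mx_diag mxE.
Qed.

(* With exact row marginals, rounding only shrinks columns and then adds a
   rank-one term of mass at most |c(X) - c|_1. *)
Lemma inner_Round_le n m (C X : 'M[R]_(n, m)) (r : 'rV_n) (c : 'rV_m) :
    nonneg_mx C -> row_feasible r X -> (forall j, 0 <= c 0 j) ->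
  inner C (Round X r c) <= inner C X + mx_norm C * norm1 (col_sums X - c).
Proof.
move=> C0 Xr c0; have [X0 Xs] := Xr.
rewrite /Round Xs.
have -> : (\row_i capped_ratio (r 0 i) (r 0 i)) = const_mx 1.
  apply/rowP => i; rewrite !mxE /capped_ratio.
  by case: ifPn => // ri; rewrite divff// minxx.
rewrite diag_const_mx mul1mx.
set y := \row_j _; set X'' := X *m diag_mx y.
have N0 : 0 <= mx_norm C by rewrite mx_normE.
have col0 j : 0 <= col_sums X 0 j by rewrite mxE sumr_ge0.
have y01 j : 0 <= y 0 j <= 1.
  rewrite mxE /capped_ratio; case: ifPn => _; first by rewrite ler01 lexx.
  by rewrite le_min divr_ge0//= ge_min lexx orbT ler01.
have XX'' : inner C X'' <= inner C X.
  apply: le_inner_nonneg => // i j; rewrite /X'' mul_mx_diag mxE ler_piMr//.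
  by case/andP: (y01 j).
(* Capping leaves the minimum of the old column sum and [c 0 j], so the deficit is the positive part
   of their difference. *)
have dcle : norm1 (c - col_sums X'') <= norm1 (col_sums X - c).
  rewrite /norm1 !big_ord1; apply: ler_sum => j _.
  rewrite [(c - _) 0 j]mxE [(- col_sums X'') 0 j]mxE col_sums_mul_diag.
  rewrite [(_ - c) 0 j]mxE [(- c) 0 j]mxE [y 0 j]mxE.
  rewrite /capped_ratio; have cj := c0 j; have := col0 j.
  case: ifPn => [/eqP -> _|x0 xge]; first by rewrite mul0r sub0r subr0 normrN.
  have xp : 0 < col_sums X 0 j by rewrite lt_neqAle eq_sym x0.
  rewrite /Order.min; case: ifPn => _; first by rewrite mulrC divfK// subrr normr0.
  by rewrite mulr1 distrC.
case: ifPn => _.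
  by apply: le_trans XX'' _; rewrite lerDl mulr_ge0// norm1_ge0.
rewrite innerDr lerD// innerC innerZl innerC.
set dr := r - _; set dc := c - _.
(* The inverse of 0 is 0, so the rank-one term disappears here and [dr] need not be shown to be
   zero. *)
have [->|d0] := eqVneq (norm1 dr) 0.
  by rewrite invr0 mul0r mulr_ge0// norm1_ge0.
have dp : 0 < norm1 dr.
  by rewrite lt_neqAle eq_sym d0 norm1_ge0.
rewrite mulrC ler_pdivrMr//; apply: le_trans (inner_outer_le _ _ _) _.
by rewrite -mulrA ler_wpM2l// [leRHS]mulrC ler_pM2l.
Qed.

End rounding.

(** * The dual mirror step *)

Section dual_step.
Context {R : realType}.
Variables (m : nat) (c : 'rV[R]_m.+1) (alpha : R).
Hypotheses (cS : simplex c) (alpha0 : 0 < alpha).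

(** The shift by [alpha / m] keeps the weight positive where [c] vanishes, so the stationarity
    condition can be solved in every coordinate. *)
Lemma smoothed_gt0 j : 0 < smoothed c alpha 0 j.
Proof. by rewrite !mxE ltr_wpDl ?divr_gt0 ?ltr0Sn//; case: cS. Qed.

Lemma smoothed_ge0 j : 0 <= smoothed c alpha 0 j.
Proof. exact/ltW/smoothed_gt0. Qed.

Lemma sum_smoothed : \sum_j smoothed c alpha 0 j = 1 + alpha.
Proof.
under eq_bigr do rewrite !mxE; rewrite big_split /= sumr_const card_ord.
by case: cS => _ ->; rewrite -[_ *+ m.+1]mulr_natr divfK// pnatr_eq0.
Qed.

Lemma DH_ge0 (u v : 'rV[R]_m.+1) : cube 1 u -> (forall j, -1 < v 0 j < 1) ->
  0 <= DH c alpha u v.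
Proof.
move=> u1 v1; apply: sumr_ge0 => j _.
by rewrite mulr_ge0 ?smoothed_ge0//; apply: bern_ge0.
Qed.

(** Both [1 + u 0 j] and [1 - u 0 j] are at most 2 and their halves add up to 1, so each coordinate
    gives at most [ln 2] times its weight. *)
Lemma DH0_le (u : 'rV[R]_m.+1) : cube 1 u -> DH c alpha u 0 <= (1 + alpha) * ln 2.
Proof.
move=> u1; rewrite -sum_smoothed mulr_suml; apply: ler_sum => j _.
rewrite ler_wpM2l ?smoothed_ge0// mxE subr0 addr0 !divr1.
have xlnx x : 0 <= x -> x <= 2 -> x * ln x <= x * ln 2 :> R.
  rewrite le_eqVlt => /orP[/eqP <-|x0 x2]; first by rewrite !mul0r.
  by rewrite ler_pM2l// ler_ln ?posrE// ltr0n.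
have /andP[u0 u2] := u1 j.
have := xlnx (1 + u 0 j) ltac:(lra) ltac:(lra).
have := xlnx (1 - u 0 j) ltac:(lra) ltac:(lra).
lra.
Qed.

Lemma DH_clip (u h : 'rV[R]_m.+1) : cube (1 / 2) u -> (forall j, -1 < h 0 j < 1) ->
  DH c alpha u (clip (1 / 2) h) <= DH c alpha u h.
Proof.
move=> u1 h1; apply: ler_sum => j _.
rewrite ler_wpM2l ?smoothed_ge0// mxE; apply: bern_clip => //; lra.
Qed.

(* The objective at u exceeds that at v by the divergence of v from u, where u
   solves the stationarity condition; so u is the only maximizer. *)
Lemma mirror_step_logit n (X : 'M[R]_(n, m.+1)) (th th' : 'rV[R]_m.+1) :
    (forall j, -1 < th 0 j < 1) -> mirror_step c alpha X th th' ->
  forall j, -1 < th' 0 j < 1 /\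
    smoothed c alpha 0 j * (logit (th' 0 j) - logit (th 0 j)) =
    (col_sums X - c) 0 j.
Proof.
move=> th1 [th'1 opt]; set g := col_sums X - c in opt *.
(* The candidate maximizer solves the first-order condition coordinatewise, by surjectivity of
   [logit]. *)
have /choice[u hu] j : exists u, -1 < u < 1 /\
    smoothed c alpha 0 j * (logit u - logit (th 0 j)) = g 0 j.
  have [u u1 ul] := logit_surj (g 0 j / smoothed c alpha 0 j + logit (th 0 j)).
  by exists u; split; rewrite // ul addrK mulrC divfK// gt_eqF ?smoothed_gt0.
have u1 : cube 1 (\row_j u j).
  by move=> j; rewrite mxE; have [/andP[] + + _] := hu j; lra.
have term_ge0 j : 0 <= smoothed c alpha 0 j * bern (th' 0 j) (u j).
  rewrite mulr_ge0 ?smoothed_ge0//; apply: bern_ge0; first exact: th'1.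
  by case: (hu j).
suff /psumr_eq0P z : \sum_j smoothed c alpha 0 j * bern (th' 0 j) (u j) = 0.
  move=> j; suff -> : th' 0 j = u j by exact: hu.
  apply: bern_eq0; [exact: th'1|by case: (hu j)|].
  have /eqP := z (fun j _ => term_ge0 j) j isT.
  by rewrite mulf_eq0 gt_eqF ?smoothed_gt0//= => /eqP.
apply/eqP; rewrite eq_le sumr_ge0// andbT.
have := opt _ u1; rewrite -subr_le0 !inner_row /DH; apply: le_trans.
rewrite -!sumrB le_eqVlt; apply/orP; left.
apply/eqP/eq_bigr => j _ /=; rewrite -!/(bern _ _) mxE.
have [uj uE] := hu j.
have := bern_three_point (th'1 j) (u1 j) (th1 j) uj.
rewrite mxE bernxx addr0 -uE => e.
have -> : bern (th' 0 j) (u j) = bern (th' 0 j) (th 0 j) - bern (u j) (th 0 j)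
  - (th' 0 j - u j) * (logit (u j) - logit (th 0 j)) by rewrite -e; ring.
ring.
Qed.

(** Stationarity replaces the weighted [logit] increments of the scalar identity by the gradient
    [col_sums X - c]. *)
Lemma DH_three_point n (X : 'M[R]_(n, m.+1)) (th th' u v : 'rV[R]_m.+1) :
    (forall j, -1 < th 0 j < 1) -> mirror_step c alpha X th th' ->
    cube 1 u -> cube 1 v ->
  DH c alpha u th - DH c alpha u th' - DH c alpha v th + DH c alpha v th' =
  inner (u - v) (col_sums X - c).
Proof.
move=> th1 st u1 v1; rewrite inner_row /DH -!sumrB -big_split.
apply: eq_bigr => j _ /=; rewrite -!/(bern _ _).
have [th'1 <-] := mirror_step_logit th1 st j.
have -> : (u - v) 0 j = u 0 j - v 0 j by rewrite !mxE.
rewrite [RHS]mulrCA -(bern_three_point (u1 j) (v1 j) (th1 j) th'1).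
ring.
Qed.

End dual_step.

(** * The LAMP iterates: potential, duality gap, telescoping *)

Section lamp.
Context {R : realType}.

(** A minimum is at most the average; clearing the denominator includes [t = 0]. *)
Lemma le_min_from1_sum (F : nat -> R) t :
  min_from1 F t * t%:R <= \sum_(0 <= s < t) F s.+1.
Proof.
have -> : min_from1 F t * t%:R = \sum_(0 <= s < t) min_from1 F t.
  by rewrite sumr_const_nat subn0 mulr_natr.
apply: ler_sum_nat => s /andP[_ st].
rewrite /min_from1; apply: ge_bigmin_seq => //.
by rewrite mem_index_iota ltnS.
Qed.

Definition cost n m (C : 'M[R]_(n, m)) (t : nat) (v : 'rV_m) : 'M[R]_(n, m) :=
  \matrix_(i, j) (t%:R * (C i j / (2 * mx_norm C) + v 0 j)).

Lemma primalE n m (C : 'M[R]_(n, m)) r t v :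
  primal C r t v = gibbs r (cost C t v).
Proof.
apply/matrixP => i j; rewrite /primal mul_diag_mx !mxE.
by congr (_ * (_ / _)); apply: eq_bigr => k _; rewrite mxE.
Qed.

Lemma cost0 n m (C : 'M[R]_(n, m)) v : cost C 0 v = 0.
Proof. by apply/matrixP => i j; rewrite !mxE mul0r. Qed.

Variables (n m : nat) (C : 'M[R]_(n, m.+1)) (r : 'rV[R]_n) (c : 'rV[R]_m.+1).
Variables (alpha : R) (nu theta bnu btheta htheta : nat -> 'rV[R]_m.+1).
Hypotheses (Cn0 : C <> 0) (rS : simplex r) (cS : simplex c).
Hypothesis alpha0 : 0 < alpha.
Hypothesis run : lamp_run C r c alpha (ln 3) nu theta bnu btheta htheta.
Variables (Xstar : 'M[R]_(n, m.+1)) (thetastar : 'rV[R]_m.+1).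
Hypotheses (XsP : couplings r c Xstar) (thsP : cube (1 / 2) thetastar).

Let X t := primal C r t (nu t).
Let bX t := primal C r t (bnu t).

Let cubeW (u : 'rV[R]_m.+1) : cube (1 / 2) u -> cube 1 u.
Proof. by move=> u1 j; have := u1 j; lra. Qed.

Let primal_rf t v : row_feasible r (primal C r t v).
Proof. by rewrite primalE; exact: gibbs_row_feasible. Qed.

Let Xstar_rf : row_feasible r Xstar.
Proof. by case: XsP. Qed.

(** Clipping keeps the iterates away from the endpoints -1 and 1, so [logit] and the divergences
    from them are well behaved. *)
Lemma theta_cube t : cube (1 / 2) (theta t).
Proof.
case: t => [|t] j; first by rewrite (lamp_theta0 run) mxE; lra.
rewrite (lamp_theta run) tanh_ln3_half mxE le_max lexx /= ge_max ge_min lexx orbT.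
by rewrite andbT; lra.
Qed.

Let theta_open t j : -1 < theta t 0 j < 1.
Proof. by have := theta_cube t j; lra. Qed.

Lemma btheta_cube t : cube 1 (btheta t.+1).
Proof. by case: (lamp_btheta run t). Qed.

Lemma nu_succ t : t.+1%:R *: nu t.+1 = t%:R *: nu t + btheta t.+1.
Proof.
have t0 : t.+1%:R != 0 :> R by rewrite pnatr_eq0.
by rewrite (lamp_nu run) scalerDr !scalerA !(mulrC t.+1%:R) !divfK// scale1r.
Qed.

Lemma nu_cube t : cube 1 (nu t).
Proof.
elim: t => [|t IH] j; first by rewrite (lamp_nu0 run) mxE; lra.
have t0 : 0 < t.+1%:R :> R by rewrite ltr0Sn.
have /(congr1 (fun u : 'rV[R]_m.+1 => u 0 j)) := nu_succ t.
rewrite !mxE => e.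
have /andP[a b] := btheta_cube t j; have /andP[d f] := IH j.
have := ler_wpM2l (ler0n R t) d; have := ler_wpM2l (ler0n R t) f.
rewrite mulrN1 mulr1 => f' d'; apply/andP; split; rewrite -(ler_pM2l t0) e -natr1; lra.
Qed.

(** The factor [t] in the exponent undoes the averaging in [nu], so one iteration adds the scaled
    gradient of [saddle_fun] in the coupling, taken at [btheta t.+1]. *)
Lemma cost_succ_sub t : cost C t.+1 (nu t.+1) - cost C t (nu t) =
  (2 * mx_norm C)^-1 *: C + \matrix_(i < n) btheta t.+1.
Proof.
apply/matrixP => i j.
have /(congr1 (fun u : 'rV[R]_m.+1 => u 0 j)) := nu_succ t.
by rewrite !mxE => e; rewrite !mulrDr e -natr1; ring.
Qed.

Let Npos : 0 < 2 * mx_norm C.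
Proof. by rewrite mulr_gt0// mx_norm_gt0. Qed.

(** The three-point identity is taken with costs [cost C t (nu t)] and 0, at [Xstar] and [X t]:
    [KL (X t) (X t)] vanishes, [KL Xstar (gibbs r 0)] is at most the logarithm of the number of
    columns, and the other two divergences have the favorable sign. The dual term is at most the
    column error, as [nu t] lies in the unit cube. *)
Lemma primal_gap t : (0 < t)%N ->
  inner C (X t - Xstar) <=
    2 * mx_norm C * (norm1 (col_sums (X t) - c) + ln m.+1%:R / t%:R).
Proof.
move=> t0; have tp : 0 < t%:R :> R by rewrite ltr0n.
have := KL_gibbs_three_point (cost C t (nu t)) 0 rS Xstar_rf (primal_rf t (nu t)).
have k1 := KL_gibbs0_le rS Xstar_rf.
have k2 := KL_gibbs_ge0 (cost C t (nu t)) rS Xstar_rf.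
have k3 := KL_gibbs_ge0 0 rS (primal_rf t (nu t)).
rewrite -primalE in k2 *; rewrite -/(X t) in k2 k3 *.
have -> : cost C t (nu t) - 0 =
    t%:R *: ((2 * mx_norm C)^-1 *: C + \matrix_(i < n) nu t).
  by apply/matrixP => i j; rewrite !mxE mulrC; ring.
have [_ _ cXs] := XsP.
rewrite KLxx innerZl innerDl innerZl inner_col_sums col_sumsB cXs !innerBr => e.
have := norm_inner_cube (col_sums (X t) - c) (nu_cube t).
rewrite innerBr ler_norml => /andP[nuX _].
set L := ln m.+1%:R in k1 *; set gap := inner C (X t) - inner C Xstar.
have : gap / (2 * mx_norm C) <= norm1 (col_sums (X t) - c) + L / t%:R.
  have : t%:R * (gap / (2 * mx_norm C) - norm1 (col_sums (X t) - c)) <= L.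
    apply: le_trans (_ : t%:R * (gap / (2 * mx_norm C)
      + (inner (nu t) (col_sums (X t)) - inner (nu t) c)) <= _); last first.
      by rewrite /gap; lra.
    by rewrite ler_pM2l//; lra.
  by rewrite mulrC -ler_pdivlMr//; lra.
by rewrite ler_pdivrMr// mulrC.
Qed.

Lemma saddle_gap_step s :
  saddle_fun C c (bX s.+1) thetastar - saddle_fun C c Xstar (btheta s.+1) <=
  2 * mx_norm C *
   ((KL Xstar (X s) + DH c alpha thetastar (theta s))
    - (KL Xstar (X s.+1) + DH c alpha thetastar (theta s.+1))
    + (DH c alpha (btheta s.+1) (htheta s.+1) - DH c alpha (btheta s.+1) (theta s)
       + KL (bX s.+1) (X s.+1) - KL (bX s.+1) (X s))).
Proof.
have [_ _ cXs] := XsP.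
have hst := lamp_htheta run s.
have hopen j : -1 < htheta s.+1 0 j < 1.
  by case: (mirror_step_logit cS alpha0 (theta_open s) hst j).
(* Apart from this bound the whole step is an identity. *)
have clipped : DH c alpha thetastar (theta s.+1) <= DH c alpha thetastar (htheta s.+1).
  by rewrite (lamp_theta run) tanh_ln3_half; apply: DH_clip.
have eDH := DH_three_point cS alpha0 (theta_open s) hst (cubeW thsP) (btheta_cube s).
rewrite innerC innerBr in eDH.
have eKL := KL_gibbs_three_point (cost C s.+1 (nu s.+1)) (cost C s (nu s)) rS Xstar_rf
  (primal_rf s.+1 (bnu s.+1)).
rewrite -!primalE -/(X s) -/(X s.+1) -/(bX s.+1) cost_succ_sub in eKL.
rewrite innerDl innerZl inner_col_sums col_sumsB cXs !innerBr in eKL.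
rewrite -/(bX s.+1) !(innerC (col_sums _ - c)) !innerBr in eDH.
rewrite /saddle_fun cXs subrr !innerBr.
(* [Xstar] has column sums [c], so its saddle value is the plain cost. In [eDH - eKL] the terms in
   [btheta s.+1] cancel and the scaled gap remains. *)
have -> : inner (btheta s.+1) 0 = 0.
  by rewrite inner_row big1// => j _; rewrite mxE mulr0.
rewrite mulr0 addr0 -ler_pdivrMl// mulrBr mulrDr mulKf ?gt_eqF//.
lra.
Qed.

Lemma saddle_gap_sum t :
  \sum_(0 <= s < t) (saddle_fun C c (bX s.+1) thetastar
                     - saddle_fun C c Xstar (btheta s.+1)) <=
  2 * mx_norm C * (ln m.+1%:R + (1 + alpha) * ln 2 +
   \sum_(0 <= s < t)
    (DH c alpha (btheta s.+1) (htheta s.+1) - DH c alpha (btheta s.+1) (theta s)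
     + KL (bX s.+1) (X s.+1) - KL (bX s.+1) (X s))).
Proof.
(* The telescoping potential: bounded at the start, where [X 0] is row-wise uniform and [theta 0] is
   zero, and nonnegative at the end. *)
pose Phi s := KL Xstar (X s) + DH c alpha thetastar (theta s).
have Phi0 : Phi 0%N <= ln m.+1%:R + (1 + alpha) * ln 2.
  rewrite /Phi /X primalE cost0 (lamp_theta0 run).
  by apply: lerD; [exact: KL_gibbs0_le|apply: DH0_le => //; exact: cubeW].
have Phit : 0 <= Phi t.
  rewrite /Phi /X primalE addr_ge0 ?KL_gibbs_ge0//.
  by apply: DH_ge0 => //; exact: cubeW.
apply: le_trans (ler_sum _ (fun s _ => saddle_gap_step s)) _.
rewrite -mulr_sumr ler_pM2l// big_split lerD2r.
have -> : \sum_(0 <= s < t) (Phi s - Phi s.+1) = Phi 0%N - Phi t.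
  by rewrite -opprB -telescope_sumr// -sumrN; apply: eq_bigr => s _; rewrite opprB.
lra.
Qed.

End lamp.

Theorem proposition3p4 (R : realType) (n m : nat) (C : 'M[R]_(n, m))
    (r : 'rV[R]_n) (c : 'rV[R]_m) (alpha : R)
    (nu theta bnu btheta htheta : nat -> 'rV[R]_m)
    (Xstar : 'M[R]_(n, m)) (thetastar : 'rV[R]_m) :
  nonneg_mx C -> C <> 0 -> simplex r -> simplex c -> 0 < alpha ->
  lamp_run C r c alpha (ln 3) nu theta bnu btheta htheta ->
  couplings r c Xstar -> cube (1 / 2) thetastar ->
  is_saddle_point (row_feasible r) (cube 1) (saddle_fun C c) Xstar thetastar ->
  is_argmin (couplings r c) (inner C) Xstar ->
  let X := fun t : nat => primal C r t (nu t) in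
  let bX := fun t : nat => primal C r t (bnu t) in
  let D := fun t : nat => \sum_(0 <= s < t)
    (DH c alpha (btheta s.+1) (htheta s.+1) - DH c alpha (btheta s.+1) (theta s)
     + KL (bX s.+1) (X s.+1) - KL (bX s.+1) (X s)) in
  forall t : nat, (1 <= t)%N ->
    inner C (Round (X t) r c - Xstar) <=
      4 * mx_norm C * norm1 (col_sums (X t) - c)
      + 2 * mx_norm C * ln m%:R / t%:R
    /\
    min_from1 (fun s => saddle_fun C c (bX s) thetastar
                        - saddle_fun C c Xstar (btheta s)) t <=
      2 * mx_norm C * (ln m%:R + (1 + alpha) * ln 2 + D t) / t%:R.
Proof.
case: m C c nu theta bnu btheta htheta Xstar thetastar => [|m] C c nu theta bnu
  btheta htheta Xstar thetastar C0 Cn0 rS cS alpha0 run XsP thsP _ _ X bX D t t0.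
  (* Without columns [C] would be zero; otherwise there is a column to make the partition sums
     positive. *)
  by exfalso; apply: Cn0; apply/matrixP => i [].
have tp : 0 < t%:R :> R by rewrite ltr0n.
split; last first.
  rewrite ler_pdivlMr//; apply: le_trans (le_min_from1_sum _ _) _.
  exact: saddle_gap_sum.
have Xrf : row_feasible r (X t).
  by rewrite /X primalE; exact: gibbs_row_feasible.
have rnd := inner_Round_le C0 Xrf (proj1 cS).
have gap := primal_gap Cn0 rS run XsP t0.
rewrite -/(X t) !innerBr in gap *.
(* The gap costs two multiples of this quantity and rounding one; its sign relaxes the total of
   three to the stated four. *)
have nn : 0 <= mx_norm C * norm1 (col_sums (X t) - c).
  by rewrite mulr_ge0 ?norm1_ge0// mx_normE.
lra.
Qed.
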